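(* Consider the finite complete-information game with pure-strategy Nash equilibrium and unordered actions described in the context, with payoffs $$u_i^{(\gamma,\sigma)}(a_i,y_{-i},x,\lambda,\varepsilon_i)=V_i^{(\gamma,\sigma)}(a_i,y_{-i},x,\lambda)+\varepsilon_i(a_i),\qquad V_i^{(\gamma,\sigma)}(a_i,y_{-i},x,\lambda)=v_i^\gamma(a_i,y_{-i},x)+r_i(a_i)^\top S_i(\sigma)\lambda,$$ where $v_i^\gamma(y,x)$ is affine in $\gamma$ for each $i,y,x$. Suppose that $\lambda,\varepsilon_1,\ldots,\varepsilon_I$ are mutually independent and independent of $x$, that $\lambda$ has a log-concave density $h$ not depending on $(\gamma,\sigma)$, and that the shocks $\{\varepsilon_i(a_i):i=1,\ldots,I,\ a_i\in\mathcal Y_i\}$ are independent of $(x,\lambda)$, mutually independent across players and actions, and identically distributed (standard) Type-I extreme value. Then, for each player $i$, action profile $y\in\mathcal Y$, covariate value $x\in\mathcal X$, common shock $\lambda$, and parameter $(\gamma,\sigma)$, $$\mathcal M_i^{(\gamma,\sigma)}(y_i\mid y_{-i},x,\lambda)=\frac{\exp\big(V_i^{(\gamma,\sigma)}(y_i,y_{-i},x,\lambda)\big)}{\sum_{a_i\in\mathcal Y_i}\exp\big(V_i^{(\gamma,\sigma)}(a_i,y_{-i},x,\lambda)\big)}.$$ Consequently, $$\mathcal L_{(\gamma,\sigma)}(y\mid x,\lambda)=\prod_{i=1}^I\frac{\exp\big(V_i^{(\gamma,\sigma)}(y_i,y_{-i},x,\lambda)\big)}{\sum_{a_i\in\mathcal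 Y_i}\exp\big(V_i^{(\gamma,\sigma)}(a_i,y_{-i},x,\lambda)\big)}$$ and $$\mathcal L_{(\gamma,\sigma)}(y\mid x)=\int\prod_{i=1}^I\frac{\exp\big(V_i^{(\gamma,\sigma)}(y_i,y_{-i},x,\lambda)\big)}{\sum_{a_i\in\mathcal Y_i}\exp\big(V_i^{(\gamma,\sigma)}(a_i,y_{-i},x,\lambda)\big)}\,h(\lambda)\,d\lambda.$$ For each fixed $\sigma\in\Sigma$, $\mathcal L_{(\gamma,\sigma)}(y\mid x)$ is log-concave in $\gamma$. Therefore, if $\Gamma$ is convex, then for each $\sigma\in\Sigma$ the slice $$\Gamma_I^*(\sigma)=\big\{\gamma\in\Gamma:\ \phi(y\mid x)\le\mathcal L_{(\gamma,\sigma)}(y\mid x)\ \ \forall y\in\mathcal Y,\ x\in\mathcal X\big\}$$ is convex.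
   Context: Game. Players are $i\in\{1,\ldots,I\}$; player $i$ has a finite action set $\mathcal Y_i$, and $\mathcal Y=\mathcal Y_1\times\cdots\times\mathcal Y_I$. A profile is written $y=(y_i,y_{-i})$. The covariate $x$ takes values in a discrete set $\mathcal X$. The parameter is $(\gamma,\sigma)$ with $\gamma\in\Gamma\subseteq\mathbb R^k$ and $\sigma\in\Sigma$. The unobservables are a common shock $\lambda\in\mathbb R^d$ with Lebesgue density $h$ and, for each player $i$, a vector of action-specific shocks $\varepsilon_i=(\varepsilon_i(a_i))_{a_i\in\mathcal Y_i}\in\mathbb R^{\mathcal Y_i}$; write $\varepsilon=(\varepsilon_1,\ldots,\varepsilon_I)$. Here $r_i(a_i)\in\mathbb R^{\mathcal Y_i}$ is the selector (standard basis) vector with $r_i(a_i)^\top\varepsilon_i=\varepsilon_i(a_i)$, $S_i(\sigma)$ is a $|\mathcal Y_i|\times d$ matrix depending only on $\sigma$, and ''$v_i^\gamma(y,x)$ is affine in $\gamma$'' means that $\gamma\mapsto v_i^\gamma(y,x)$ is the restriction to $\Gamma$ of an affine function on $\mathbb R^k$. The standard Type-I extreme value distribution has cumulative distribution function $t\mapsto\exp(-e^{-t})$. Equilibrium. $G_{(\gamma,\sigma)}(x,\lambda,\varepsilon)$ is the set of pure-strategy Nash equilibria: the set of $y\in\mathcal Y$ such that $u_i^{(\gamma,\sigma)}(y_i,y_{-i},x,\lambda,\varepsilon_i)\ge u_i^{(\gamma,\sigma)}(a_i,y_{-i},x,\lambda,\varepsilon_i)$ for all $a_i\in\mathcal Y_i$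 and all $i$. Probabilities. The player-level best-response probability is $$\mathcal M_i^{(\gamma,\sigma)}(y_i\mid y_{-i},x,\lambda)=\Pr_{\varepsilon_i}\big(u_i^{(\gamma,\sigma)}(y_i,y_{-i},x,\lambda,\varepsilon_i)\ge u_i^{(\gamma,\sigma)}(a_i,y_{-i},x,\lambda,\varepsilon_i)\ \text{for all } a_i\in\mathcal Y_i\mid x,\lambda\big).$$ The singleton-event generalized likelihoods are $$\mathcal L_{(\gamma,\sigma)}(y\mid x,\lambda)=\Pr_{\varepsilon}\big(y\in G_{(\gamma,\sigma)}(x,\lambda,\varepsilon)\mid x,\lambda\big),\qquad \mathcal L_{(\gamma,\sigma)}(y\mid x)=\Pr_{\varepsilon,\lambda}\big(y\in G_{(\gamma,\sigma)}(x,\lambda,\varepsilon)\mid x\big).$$ By independence, the conditional probabilities are computed with $x$ (and $\lambda$, where it is conditioned on) held fixed, under the unconditional law of the remaining shocks. Data. $\phi$ is a given vector of conditional choice probabilities: for each $x\in\mathcal X$, $\phi(\cdot\mid x)$ is a probability distribution on $\mathcal Y$. Log-concavity. A nonnegative function $f$ on a subset $C$ of a Euclidean space is log-concave if $f((1-t)a+tb)\ge f(a)^{1-t}f(b)^t$ for all $t\in(0,1)$ and all $a,b\in C$ with $(1-t)a+tb\in C$ (zeros are allowed). Functions of $\gamma$ are considered on $\Gamma$. *)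

(* Defs.v *)
From HB Require Import structures.
From mathcomp Require Import all_boot all_order all_algebra.
From mathcomp Require Import all_classical all_reals all_analysis.

Set Implicit Arguments.
Unset Strict Implicit.
Unset Printing Implicit Defensive.

Import Order.TTheory GRing.Theory Num.Theory.
Import numFieldNormedType.Exports.

Local Open Scope classical_set_scope.
Local Open Scope ring_scope.

Section lebesgue_tuple.
Context {R : realType}.
Local Open Scope ereal_scope.

Definition cons_pair d (p : measurableTypeR R * d.-tuple (measurableTypeR R)) :
  d.+1.-tuple (measurableTypeR R) := [tuple of p.1 :: p.2].

Lemma measurable_cons_pair d : measurable_fun setT (@cons_pair d).
Proof. exact: measurable_cons. Qed.

Section lebesgue_cons.
Variables (d : nat)
  (m : {sigma_finite_measure set (d.-tuple (measurableTypeR R)) -> \bar R}).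

Definition lebesgue_cons : set (d.+1.-tuple (measurableTypeR R)) -> \bar R :=
  pushforward (lebesgue_measure \x m) (@cons_pair d).

Let mc := @measurable_cons_pair d.

Let p : {measure set (measurableTypeR R * d.-tuple (measurableTypeR R))
                 -> \bar R} := lebesgue_measure \x m.

Let lebesgue_cons0 : lebesgue_cons set0 = 0.
Proof. by rewrite /lebesgue_cons /pushforward preimage_set0 (measure0 p). Qed.

Let lebesgue_cons_ge0 A : 0 <= lebesgue_cons A.
Proof. exact: (measure_ge0 p). Qed.

Let lebesgue_cons_sigma_additive : semi_sigma_additive lebesgue_cons.
Proof.
exact: (@measure_semi_sigma_additive _ _ _
  (measure_function_pushforward__canonical__measure_function_Measure p mc)).
Qed.

HB.instance Definition _ := isMeasure.Build _ _ _ lebesgue_cons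
  lebesgue_cons0 lebesgue_cons_ge0 lebesgue_cons_sigma_additive.

Let lebesgue_cons_sigma_finite : sigma_finite setT lebesgue_cons.
Proof.
have /sigma_finiteP[F [TF ndF Foo]] := sigma_finiteT (@lebesgue_measure R).
have /sigma_finiteP[G [TG ndG Goo]] := sigma_finiteT m.
pose split_cons (t : d.+1.-tuple (measurableTypeR R)) :
  measurableTypeR R * d.-tuple (measurableTypeR R) :=
  (tnth t ord0, [tuple of behead t]).
have msplit : measurable_fun setT split_cons.
  apply: measurable_fun_pair; first exact: measurable_tnth.
  exact: measurable_behead.
have consK : cancel (@cons_pair d) split_cons.
  by case=> x t; congr pair; apply/val_inj.
exists (fun i => split_cons @^-1` (F i `*` G i)) => [|i].
  rewrite -preimage_bigcup (_ : \bigcup_i _ = setT) ?preimage_setT//.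
  rewrite -subTset => -[x t] _.
  have [j _ Fx] : (\bigcup_i F i) x by rewrite -TF.
  have [k _ Gt] : (\bigcup_i G i) t by rewrite -TG.
  exists (maxn j k) => //; split.
  - by move: x Fx; exact/subsetPset/ndF/leq_maxl.
  - by move: t Gt; exact/subsetPset/ndG/leq_maxr.
have [mF Fi] := Foo i; have [mG Gi] := Goo i; split.
  by rewrite -[X in measurable X]setTI; apply: msplit => //; exact: measurableX.
rewrite /lebesgue_cons /pushforward -comp_preimage.
rewrite (_ : split_cons \o _ = id); last by apply/funext => u; exact: consK.
by rewrite preimage_id product_measure1E// lte_mul_pinfty// ge0_fin_numE.
Qed.

HB.instance Definition _ := Measure_isSigmaFinite.Build _ _ _ lebesgue_cons
  lebesgue_cons_sigma_finite.

End lebesgue_cons.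

(* d-dimensional Lebesgue measure on the product Borel sigma-algebra: the
   unit mass on the one-point space R^0, then the product of lebesgue_measure
   and lebesgue_tuple d transported along R x R^d ~ R^(d+1). *)
Fixpoint lebesgue_tuple (d : nat) :
    {sigma_finite_measure set (d.-tuple (measurableTypeR R)) -> \bar R} :=
  match d with
  | 0%N => dirac ([tuple] : 0.-tuple (measurableTypeR R))
  | d'.+1 => lebesgue_cons (lebesgue_tuple d')
  end.

Lemma lebesgue_tuple_box d (A : 'I_d -> set (measurableTypeR R)) :
  (forall i, measurable (A i)) ->
  lebesgue_tuple d [set t | forall i, A i (tnth t i)] =
  \prod_(i < d) lebesgue_measure (A i).
Proof.
elim: d A => [|d IHd] A mA /=.
  by rewrite big_ord0 diracE mem_set// => -[].
have mB : measurable [set t : d.-tuple (measurableTypeR R) |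
    forall i, A (lift ord0 i) (tnth t i)].
  rewrite (_ : mkset _ = \bigcap_(i in [set: 'I_d])
      (@tnth d (measurableTypeR R) ^~ i @^-1` A (lift ord0 i))).
    apply: fin_bigcap_measurable => // i _.
    by rewrite -[X in measurable X]setTI; exact: measurable_tnth.
  by apply/seteqP; split => [t tA i _|t tA i]; exact: tA.
rewrite big_ord_recl -IHd// -product_measure1E// /lebesgue_cons /pushforward.
congr (product_measure1 _ _ _); apply/seteqP; split => -[x t] /=.
  move=> tA; split => /= [|i]; first exact: (tA ord0).
  by have := tA (lift ord0 i); rewrite tnthS.
move=> [/= Ax tA] i; case: (unliftP ord0 i) => [j|] -> //=.
by rewrite tnthS.
Qed.

End lebesgue_tuple.

Section log_concavity.
Context {R : realType}.

(* [powR] satisfies 0 `^ s = 0 for s != 0, so zeros of f are allowed. *)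
Definition log_concave_on (E : lmodType R) (C : set E) (f : E -> R) :=
  (forall a, C a -> 0 <= f a) /\
  forall (t : R) (a b : E), 0 < t < 1 -> C a -> C b ->
    C ((1 - t) *: a + t *: b) ->
    f a `^ (1 - t) * f b `^ t <= f ((1 - t) *: a + t *: b).

Definition affine_on k (C : set 'cV[R]_k) (f : 'cV[R]_k -> R) :=
  exists (c : 'cV[R]_k) (b : R), forall g, C g ->
    f g = \sum_(j < k) c j ord0 * g j ord0 + b.

End log_concavity.

Section independence.
Context {R : realType} {dO : measure_display} {Omega : measurableType dO}.
Variable P : probability Omega R.

(* Sigma-algebra generated by a random element. *)
Definition rv_events d' (T : measurableType d') (f : Omega -> T) :
    set (set Omega) :=
  preimage_set_system setT f measurable.

(* Sigma-algebra generated jointly by a family of classes of events. *)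
Definition joint_events (J : Type) (F : J -> set (set Omega)) :
    set (set Omega) :=
  <<s \bigcup_j F j >>.

Definition independent2 (F G : set (set Omega)) :=
  forall A B, F A -> G B -> P (A `&` B) = (P A * P B)%E.

Definition mutually_independent (J : finType) (F : J -> set (set Omega)) :=
  forall (K : {set J}) (A : J -> set Omega), (forall j, F j (A j)) ->
    P (\bigcap_(j in [set` K]) A j) = (\prod_(j in K) P (A j))%E.

End independence.

Section shock_events.
Context {R : realType} {dO : measure_display} {Omega : measurableType dO}.
Context {P : probability Omega R}.
Context {n : nat} {Y : 'I_n -> finType} (eps : forall i, Y i -> {RV P >-> R}).

Definition scalar_shock_events (ia : {i : 'I_n & Y i}) : set (set Omega) :=
  rv_events (eps (tagged ia)).

Definition player_shock_events (i : 'I_n) : set (set Omega) :=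
  joint_events (fun a : Y i => rv_events (eps a)).

(* The family (lam, eps_1, ..., eps_n); [None] is the index of lam. *)
Definition all_shock_events d' (T : measurableType d') (lam : {RV P >-> T})
    (o : option 'I_n) : set (set Omega) :=
  if o is Some i then player_shock_events i else rv_events lam.

End shock_events.

Section game.
Context {R : realType} {n : nat} (Y : 'I_n -> finType).

(* The players are the elements of 'I_n; Y i is the action set of player i. *)
Definition profile := {dffun forall i : 'I_n, Y i}.

(* The profile (a, y_{-i}). *)
Definition deviate (y : profile) (i : 'I_n) (a : Y i) : profile :=
  finfun (@dfwith _ _ y i a).

Context (X Sigma : Type) (k d : nat).
Variables (v : 'cV[R]_k -> forall i : 'I_n, profile -> X -> R)
          (S : Sigma -> forall i : 'I_n, 'M[R]_(#|Y i|, d)).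

Definition selector (i : 'I_n) (a : Y i) : 'cV[R]_#|Y i| :=
  delta_mx (enum_rank a) ord0.

(* Here and below, y enters only through y_{-i}: its i-th component is
   overwritten by a. *)
Definition Vpayoff (g : 'cV[R]_k) (s : Sigma) (i : 'I_n) (a : Y i)
    (y : profile) (x : X) (l : 'cV[R]_d) : R :=
  v g i (deviate y a) x + ((selector a)^T *m S s i *m l) ord0 ord0.

Definition payoff (g : 'cV[R]_k) (s : Sigma) (i : 'I_n) (a : Y i)
    (y : profile) (x : X) (l : 'cV[R]_d) (e : Y i -> R) : R :=
  Vpayoff g s a y x l + e a.

Definition best_response (g : 'cV[R]_k) (s : Sigma) (i : 'I_n) (b : Y i)
    (y : profile) (x : X) (l : 'cV[R]_d) (e : Y i -> R) : Prop :=
  forall a : Y i, payoff g s a y x l e <= payoff g s b y x l e.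

Definition equilibria (g : 'cV[R]_k) (s : Sigma) (x : X) (l : 'cV[R]_d)
    (e : forall i, Y i -> R) : set profile :=
  [set y : profile | forall i, best_response g s (y i) y x l (e i)].

Section likelihood.
Context {dO : measure_display} {Omega : measurableType dO}.
Variables (P : probability Omega R)
          (eps : forall i : 'I_n, Y i -> {RV P >-> R}).

(* Probabilities given x and lambda are taken at fixed x and lambda, under the
   unconditional law of the remaining shocks. *)
Definition best_response_prob (g : 'cV[R]_k) (s : Sigma) (i : 'I_n) (b : Y i)
    (y : profile) (x : X) (l : 'cV[R]_d) : R :=
  fine (P [set w | best_response g s b y x l (fun a => eps a w)]).

Definition likelihood_given (g : 'cV[R]_k) (s : Sigma) (y : profile) (x : X)
    (l : 'cV[R]_d) : R :=
  fine (P [set w | equilibria g s x l (fun i (a : Y i) => eps a w) y]).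

Definition likelihood (lam : Omega -> 'cV[R]_d) (g : 'cV[R]_k) (s : Sigma)
    (y : profile) (x : X) : R :=
  fine (P [set w | equilibria g s x (lam w) (fun i (a : Y i) => eps a w) y]).

Definition identified_slice (Gamma : set 'cV[R]_k) (phi : profile -> X -> R)
    (lam : Omega -> 'cV[R]_d) (s : Sigma) : set 'cV[R]_k :=
  [set g | Gamma g /\ forall y x, phi y x <= likelihood lam g s y x].

End likelihood.
End game.

Section density.
Context {R : realType} {dO : measure_display} {Omega : measurableType dO}.
Context {d : nat}.

(* The product measurable structure lives on tuples, linear algebra on column
   vectors; [colv] identifies the two copies of R^d. *)
Definition colv (t : d.-tuple (measurableTypeR R)) : 'cV[R]_d :=
  \col_i tnth t i.

Definition has_lebesgue_density (P : probability Omega R)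
    (lam : {RV P >-> d.-tuple (measurableTypeR R)}) (h : 'cV[R]_d -> R) :=
  [/\ measurable_fun setT (h \o colv),
      forall l, 0 <= h l
    & forall B, measurable B ->
        distribution P lam B =
        (\int[lebesgue_tuple d]_(t in B) (h (colv t))%:E)%E].

End density.

Definition std_gumbel {R : realType} {dO : measure_display}
    {Omega : measurableType dO} (P : probability Omega R)
    (e : {RV P >-> R}) :=
  forall t : R, cdf e t = (expR (- expR (- t)))%:E.

(* Main.v *)
Require Import Defs.
From HB Require Import structures.
From mathcomp Require Import all_boot all_order all_algebra.
From mathcomp Require Import all_classical all_reals all_analysis.
From mathcomp Require Import measurable_realfun ring lra.

Set Implicit Arguments.
Unset Strict Implicit.
Unset Printing Implicit Defensive.

Import Order.TTheory GRing.Theory Num.Theory.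
Import numFieldNormedType.Exports.

Local Open Scope classical_set_scope.
Local Open Scope ring_scope.

(* The variables exp (- (V a + eps a)) are independent exponential clocks of
   rates exp (V a), and a best response is a clock that rings first; splitting
   the half-line into short intervals turns the probability that clock b wins
   into geometric sums with limit rate b / total rate.  Integrating the shocks
   out first gives the integral formula.  Log-sum-exp is convex and payoffs are
   affine, so the integrand is jointly log-concave in (gamma, lambda), and
   Prekopa-Leindler makes its integral over lambda log-concave in gamma.

   Prekopa-Leindler goes by induction on the dimension.  On the line, it is the
   layer-cake formula applied to |C| >= (1 - t) |A| + t |B|, valid when
   C contains (1 - t) A + t B: for a in A and b in B, the points of A left of a
   paired with b and the points of B right of b paired with a land on opposite
   sides of (1 - t) a + t b. *)

(** * The Prekopa-Leindler inequality *)

Section brunn_minkowski.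
Context {R : realType}.
Local Notation mu := (@lebesgue_measure R).
Local Notation RM := (measurableTypeR R).
Implicit Types A B C : set RM.

Lemma measurable_affine (c b : R) : measurable_fun setT (fun x : RM =>
  c * x + b : RM).
Proof. by apply: measurable_funD => //; exact: measurable_funM. Qed.

(** Uniqueness of Lebesgue measure: the right-hand side is a scaled pushforward of [mu], and it
    gives every half-open interval its length. *)
Lemma lebesgue_measure_affine (c b : R) A : 0 < c -> measurable A ->
  mu A = (c%:E * mu ((fun x : RM => c * x + b)%R @^-1` A))%E.
Proof.
move=> c0 mA.
pose f (x : RM) : RM := c * x + b.
have mf : measurable_fun setT f by exact: measurable_affine.
pose c' : {nonneg R} := NngNum (ltW c0).
pose nu : {measure set RM -> \bar R} :=
  mscale c' (measure_function_pushforward__canonical__measure_function_Measure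
    mu mf).
rewrite -[RHS]/(nu A); apply: lebesgue_measure_unique => // _ [[u v] /= uv <-].
rewrite [LHS]lebesgue_measure_itv/= /nu /= /mscale /= /pushforward.
have -> : f @^-1` `]u, v] = `](u - b) / c, (v - b) / c]%classic.
  by apply/seteqP; split => x /=;
    rewrite !in_itv/= /f ltr_pdivrMr// ler_pdivlMr// ltrBlDr lerBrDr (mulrC x).
rewrite lebesgue_measure_itv/= !lte_fin ltr_pM2r ?invr_gt0// ltrD2r.
case: ifPn => _; last by rewrite mule0.
by rewrite -!EFinD -EFinM; congr (_%:E); field; rewrite gt_eqF.
Qed.

Lemma cvg_set_measure_le (A : set RM) (F : nat -> set RM) (u : \bar R) :
  (forall n, measurable (F n)) -> nondecreasing_seq F -> A `<=` \bigcup_n F n ->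
  measurable A -> (forall n, mu (F n) <= u)%E -> (mu A <= u)%E.
Proof.
move=> mF ndF AF mA Fu.
have mU : measurable (\bigcup_n F n) by exact: bigcup_measurable.
apply: (@le_trans _ _ (mu (\bigcup_n F n))); first by apply: le_measure;
  rewrite ?inE.
have cF : mu (F n) @[n --> \oo] --> mu (\bigcup_n F n).
  exact: (@nondecreasing_cvg_mu _ _ _ mu).
rewrite -(cvg_lim _ cF)//; apply: lime_le; first by apply/cvg_ex; eexists;
  exact: cF.
by near=> n.
Unshelve. all: by end_near. Qed.

(** Allows cutting [A] only at its own points: up to a null set, [A] is an increasing union of
    pieces cut off by rays, each contained in a ray that ends at a point of [A]. *)
Lemma measure_left_rays_le A (u : \bar R) : measurable A -> A !=set0 ->
  (forall a, A a -> mu (A `&` `]-oo, a[) <= u)%E -> (mu A <= u)%E.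
Proof.
move=> mA A0 Au.
have mI (x : R) : measurable (A `&` `]-oo, x[) by apply: measurableI.
have [ubA|nubA] := pselect (has_ubound A); last first.
  apply: (@cvg_set_measure_le A (fun n => A `&` `]-oo, n%:R[)) => //.
  - move=> m n mn; apply/subsetPset; apply: setIS => x /=;
      rewrite !in_itv/= => /lt_le_trans; apply.
    by rewrite ler_nat.
  - move=> x Ax; exists (Num.truncn x).+1 => //; split => //=; rewrite in_itv/=.
    exact: Num.Theory.truncnS_gt.
  (* As [A] is unbounded above, the ray ending at [n] lies inside one ending at some [a] in [A]. *)
  - move=> n; have [a Aa na] : exists2 a, A a & n%:R < a.
      apply: contrapT => h; case: nubA; exists n%:R => x Ax.
      by rewrite leNgt; apply/negP => nx; apply: h; exists x.
    apply: le_trans (Au a Aa); apply: le_measure; rewrite ?inE//.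
    by apply: setIS => x /=; rewrite !in_itv/= => /lt_trans; apply.
have hsA : has_sup A by [].
pose M := sup A.
(* Dropping the supremum, possibly attained, costs at most one point, which is null; below [M] the
   rays ending at [M - 1 / (n + 1)] exhaust [A]. *)
have -> : mu A = mu (A `&` `]-oo, M[).
  apply/eqP; rewrite eq_le; apply/andP; split; last first.
    by apply: le_measure; rewrite ?inE.
  apply: (@le_trans _ _ (mu ((A `&` `]-oo, M[) `|` [set M]))).
    apply: le_measure; rewrite ?inE//; first by apply: measurableU.
    move=> x Ax /=; have := sup_upper_bound hsA Ax;
      rewrite le_eqVlt => /orP[/eqP ->|xM].
      by right.
    by left; split => //=; rewrite in_itv.
  apply: le_trans; first exact: measureU2.
  by have := @lebesgue_measure_set1 R M => /= ->; rewrite adde0.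
apply: (@cvg_set_measure_le _ (fun n => A `&` `]-oo, M - n.+1%:R^-1[)) => //.
- move=> m n mn; apply/subsetPset; apply: setIS => x /=;
    rewrite !in_itv/= => /lt_le_trans; apply.
  by rewrite lerB// lef_pV2 ?posrE// ler_nat.
- move=> x [Ax]; rewrite /= in_itv/= => xM.
  have d0 : 0 < M - x by rewrite subr_gt0.
  exists (Num.truncn (M - x)^-1) => //; split => //=; rewrite in_itv/=.
  rewrite ltrBrDr addrC -ltrBrDr invf_plt ?posrE//;
    exact: Num.Theory.truncnS_gt.
- move=> n; have [a Aa na] : exists2 a, A a & M - n.+1%:R^-1 < a.
    by apply: sup_adherent.
  apply: le_trans (Au a Aa); apply: le_measure; rewrite ?inE//.
  by apply: setIS => x /=; rewrite !in_itv/= => /lt_trans; apply.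
Qed.

(** The reflection [x |-> - x] preserves [mu] and exchanges left and right rays. *)
Lemma measure_right_rays_le A (u : \bar R) : measurable A -> A !=set0 ->
  (forall a, A a -> mu (A `&` `]a, +oo[) <= u)%E -> (mu A <= u)%E.
Proof.
move=> mA [a0 Aa0] Au.
have mN (B : set RM) : measurable B -> measurable ((-%R : RM -> RM) @^-1` B).
  by move=> mB; rewrite -[X in measurable X]setTI; exact: oppr_measurable.
have NE (B : set RM) : measurable B -> mu ((-%R : RM -> RM) @^-1` B) = mu B.
  by move=> mB; have /= := lebesgue_measureN mB; rewrite /pushforward.
rewrite -NE//; apply: measure_left_rays_le; first exact: mN.
  by exists (- a0) => /=; rewrite opprK.
move=> a Aa; apply: le_trans (Au _ Aa); rewrite -[leRHS]NE;
  last exact: measurableI.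
apply: le_measure; rewrite ?inE.
- by apply: measurableI => //; exact: mN.
- by apply: mN; exact: measurableI.
- by move=> x [Ax /=]; rewrite !in_itv/= andbT => xa; split => //=;
    rewrite ?in_itv/= ?andbT ltrN2.
Qed.

(** First proved for a left piece of [A] and a right piece of [B], then extended to all of [A] by
    letting [a] vary, and to all of [B] by letting [b] vary. *)
Lemma brunn_minkowski1 (t : R) A B C : 0 < t < 1 ->
  measurable A -> measurable B -> measurable C -> A !=set0 -> B !=set0 ->
  (forall x y, A x -> B y -> C ((1 - t) * x + t * y)) ->
  ((1 - t)%:E * mu A + t%:E * mu B <= mu C)%E.
Proof.
move=> /andP[t0 t1] mA mB mC A0 B0 ABC.
have s0 : 0 < 1 - t by rewrite subr_gt0.
(* The affine maps [x |-> (1 - t) * x + t * b] and [y |-> (1 - t) * a + t * y] send the two pieces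
   into [C], strictly to the left and to the right of [m], so the measures of their images add
   up. *)
have rays a b : A a -> B b ->
    ((1 - t)%:E * mu (A `&` `]-oo, a[) + t%:E * mu (B `&` `]b, +oo[) <= mu C)%E.
  move=> Aa Bb; pose m := (1 - t) * a + t * b.
  have mCl : measurable (C `&` `]-oo, m[) by exact: measurableI.
  have mCr : measurable (C `&` `]m, +oo[) by exact: measurableI.
  apply: (@le_trans _ _ (mu (C `&` `]-oo, m[) + mu (C `&` `]m, +oo[))%E);
    last first.
    rewrite -measureU//; last first.
      apply/seteqP; split => // x [[_ /= +] [_ /=]]; rewrite !in_itv/= andbT.
      by move=> xm /(lt_trans xm); rewrite ltxx.
    apply: le_measure; rewrite ?inE//; first exact: measurableU.
    by move=> x [[]|[]].
  apply: leeD.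
  - rewrite (@lebesgue_measure_affine (1 - t) (t * b) (C `&` _))//.
    apply: lee_wpmul2l; first by rewrite lee_fin ltW.
    apply: le_measure; rewrite ?inE.
    + exact: measurableI.
    + by rewrite -[X in measurable X]setTI; exact: measurable_affine.
    + move=> x [Ax /=]; rewrite in_itv/= => xa; split; first exact: ABC.
      by rewrite /= in_itv/= /m ltrD2r ltr_pM2l.
  - rewrite (@lebesgue_measure_affine t ((1 - t) * a) (C `&` _))//.
    apply: lee_wpmul2l; first by rewrite lee_fin ltW.
    apply: le_measure; rewrite ?inE.
    + exact: measurableI.
    + by rewrite -[X in measurable X]setTI; exact: measurable_affine.
    + move=> x [Bx /=]; rewrite in_itv/= andbT => bx; split.
        by rewrite /= addrC; exact: ABC.
      by rewrite /= in_itv/= andbT /m addrC ltrD2r ltr_pM2l.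
have [->|Cfin] := eqVneq (mu C) +oo%E; first by rewrite leey.
have Cnum : mu C \is a fin_num.
  by rewrite ge0_fin_numE ?measure_ge0// lt_neqAle Cfin leey.
(* Isolates one measure in the inequality, so that the lemmas on rays can bound it; since [mu C] is
   finite, the other term is finite too and may be subtracted. *)
have scale (k : R) (x v : \bar R) : 0 < k -> (0 <= v)%E -> (0 <= x)%E ->
    ((k%:E * x + v <= mu C)%E <-> (x <=
      k^-1%:E * (mu C - v))%E /\ v \is a fin_num).
  move=> k0 v0 x0.
  rewrite -(fineK Cnum); case: v v0 => [v| |]// v0; last first.
    split; last by case.
    by rewrite addey ?leye_eq// gt_eqF// (lt_le_trans ltNy0)// mule_ge0//
      lee_fin ltW.
  rewrite -EFinB -EFinM.
  case: x x0 => [x| |]// x0; last first.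
    rewrite gt0_muley ?lte_fin//.
    split => [|[]]; by rewrite ?leye_eq.
  by rewrite -EFinM -EFinD !lee_fin ler_pdivlMl// lerBrDr; split => // -[].
have step1 b : B b -> ((1 - t)%:E * mu A + t%:E * mu (B `&` `]b, +oo[) <=
  mu C)%E.
  move=> Bb.
  have p0 : (0 <= t%:E * mu (B `&` `]b, +oo[))%E by rewrite mule_ge0// lee_fin
    ltW.
  have [a0 Aa0] := A0.
  have [_ vfin] := (scale _ _ _ s0 p0 (measure_ge0 mu _)).1 (rays _ _ Aa0 Bb).
  apply/scale => //; split => //; apply: measure_left_rays_le => // a Aa.
  by have [] := (scale _ _ _ s0 p0 (measure_ge0 mu _)).1 (rays _ _ Aa Bb).
have [b0 Bb0] := B0.
have p0 : (0 <= (1 - t)%:E * mu A)%E by rewrite mule_ge0// lee_fin ltW.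
have step1' b : B b -> (t%:E * mu (B `&` `]b, +oo[) + (1 - t)%:E * mu A <=
  mu C)%E.
  by move=> Bb; rewrite addeC; exact: step1.
have [_ vfin] := (scale _ _ _ t0 p0 (measure_ge0 mu _)).1 (step1' _ Bb0).
rewrite addeC; apply/scale => //; split => //;
  apply: measure_right_rays_le => // b Bb.
by have [] := (scale _ _ _ t0 p0 (measure_ge0 mu _)).1 (step1' _ Bb).
Qed.

End brunn_minkowski.

(** * Weighted geometric means of extended reals *)

Section geo_le.
Context {R : realType}.

(* u^(1-t) v^t <= w, without powers of possibly infinite u, v; in this form
   the one-dimensional statement can be iterated on marginals. *)
Definition geo_le (t : R) (u v w : \bar R) :=
  forall a b : R, 0 < a -> 0 < b -> (a%:E <= u)%E -> (b%:E <= v)%E ->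
    ((a `^ (1 - t) * b `^ t)%:E <= w)%E.

(** Multiplying [a] and [b] by [c < 1] makes the bounds strict and multiplies the geometric mean by
    [c]; then [c] tends to 1. *)
Lemma geo_leW (t : R) (u v w : \bar R) :
  (forall a b : R, 0 < a -> 0 < b -> (a%:E < u)%E -> (b%:E < v)%E ->
    ((a `^ (1 - t) * b `^ t)%:E <= w)%E) -> geo_le t u v w.
Proof.
move=> H a b a0 b0 au bv; set K := _ * _.
have K0 : 0 < K by rewrite mulr_gt0// powR_gt0.
have cK (c : R) : 0 < c < 1 -> ((c * K)%:E <= w)%E.
  move=> /andP[c0 c1]; have -> : c * K = (c * a) `^ (1 - t) * (c * b) `^ t.
    rewrite !powRM ?ltW// mulrACA -powRD ?subrK ?powRr1 ?ltW//.
    by rewrite (gt_eqF c0)/= implybT.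
  apply: H; rewrite ?mulr_gt0//.
    by apply: lt_le_trans au; rewrite lte_fin gtr_pMl.
  by apply: lt_le_trans bv; rewrite lte_fin gtr_pMl.
apply/lee_addgt0Pr => e e0.
have Ke0 : 0 < K + e by rewrite addr_gt0.
(* With [c = K / (K + e)] the loss [K - c * K = K * e / (K + e)] is at most [e]. *)
have c01 : 0 < K / (K + e) < 1.
  by rewrite divr_gt0//= ltr_pdivrMr// mul1r ltrDl.
apply: le_trans (leeD (cK _ c01) (lexx _)).
rewrite -EFinD lee_fin -lerBlDr mulrAC ler_pdivlMr//.
by rewrite mulrBl mulrDr; nra.
Qed.

(** Young's inequality for the powers of [a] and [b], with conjugate exponents [1 / (1 - t)] and
    [1 / t]. *)
Lemma powR_amgm (t a b : R) : 0 < t < 1 -> 0 < a -> 0 < b ->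
  a `^ (1 - t) * b `^ t <= (1 - t) * a + t * b.
Proof.
move=> /andP[t0 t1] a0 b0; have s0 : 0 < 1 - t by rewrite subr_gt0.
have := @conjugate_powR R (a `^ (1 - t)) (b `^ t) (1 - t)^-1 t^-1.
rewrite !powR_ge0 !invr_gt0 !invrK subrK -!powRrM !mulfV ?gt_eqF//.
rewrite !powRr1 ?(ltW a0) ?(ltW b0)//.
by rewrite (mulrC a) (mulrC b); apply.
Qed.

End geo_le.

(** * The Prekopa-Leindler inequality on the line *)

Section prekopa_leindler1.
Import HBNNSimple.
Context {R : realType}.
Local Notation mu := (@lebesgue_measure R).
Local Notation RM := (measurableTypeR R).
Local Open Scope ereal_scope.

Lemma lebesgue_unit_levels (u : \bar R) : 0 <= u ->
  mu (`]0%R, 1%R[ `&` [set s : RM | s%:E <= u]) = mine u 1.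
Proof.
case: u => [r| |]// r0; last first.
  rewrite (_ : _ `&` _ = `]0%R, 1%R[%classic); last first.
    by apply/seteqP; split => x /=; [case|split; rewrite ?leey].
  by rewrite lebesgue_measure_itv/= lte01 oppr0 adde0 /mine ltNge leey.
have [r1|r1] := ltP r 1%R.
  rewrite (_ : _ `&` _ = `]0%R, r]%classic).
    rewrite lebesgue_measure_itv/= /mine !lte_fin r1 oppr0 adde0.
    by case: ltP => // r0'; congr (_%:E); apply/le_anti/andP; split;
      rewrite ?lee_fin.
  apply/seteqP; split => x /=; rewrite !in_itv/= lee_fin.
    by move=> [/andP[-> _] ->].
  by move=> /andP[-> xr]; split => //; exact: le_lt_trans r1.
rewrite (_ : _ `&` _ = `]0%R, 1%R[%classic).
  rewrite lebesgue_measure_itv/= lte01 oppr0 adde0 /mine lte_fin ltNge r1//.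
apply/seteqP; split => x /=; first by case.
move=> x01; split => //; move: x01; rewrite in_itv/= lee_fin => /andP[_ x1].
exact: le_trans (ltW x1) r1.
Qed.

Definition unit_levels (F : RM -> \bar R) : set (RM * RM) :=
  [set p : RM * RM | (0 < (p.1 : R) < 1)%R /\ (p.1 : R)%:E <= F p.2].

Lemma measurable_levels (F : RM -> \bar R) : measurable_fun setT F ->
  measurable (unit_levels F).
Proof.
move=> mF; rewrite (_ : unit_levels F =
    (fst @^-1` `]0%R, 1%R[) `&` ([set: RM * RM] `&` [set p | (p.1 : R)%:E <=
      F p.2])).
  apply: measurableI.
    by rewrite -[X in measurable X]setTI; exact: measurable_fst.
  apply: measurable_lee => //; last exact: measurableT_comp.
  by apply/measurable_EFinP; exact: measurable_fst.
by rewrite setTI; apply/seteqP; split => -[s x] /=; rewrite in_itv.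
Qed.

Lemma measurable_levels_measure (F : RM -> \bar R) : measurable_fun setT F ->
  measurable_fun (`]0%R, 1%R[ : set RM) (fun s : RM =>
    mu [set x : RM | s%:E <= F x]).
Proof.
move=> mF.
have := measurable_fun_xsection mu (measurable_levels mF).
move=> /(measurable_funS measurableT (@subsetT _ (`]0%R, 1%R[%classic : set
  RM))).
apply: eq_measurable_fun => s; rewrite inE /= in_itv/= => s01.
by congr (mu _); apply/seteqP; split => x /=; rewrite /xsection/= inE/= ;
  [case | ].
Qed.

(** Tonelli for the part of the subgraph of [F] at heights in []0, 1[]: its sections at fixed height
    are superlevel sets, those at fixed [x] have length [mine (F x) 1]. *)
Lemma layer_cake (F : RM -> \bar R) : measurable_fun setT F ->
  (forall x, 0 <= F x) ->
  \int[mu]_(s in `]0%R, 1%R[) mu [set x : RM | s%:E <= F x] =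
  \int[mu]_x mine (F x) 1.
Proof.
move=> mF F0; have mN := measurable_levels mF.
have := @indic_fubini_tonelli _ _ _ _ _ mu mu _ mN.
rewrite indic_fubini_tonelli_FE// indic_fubini_tonelli_GE// => E.
transitivity (\int[mu]_y (mu \o ysection (unit_levels F)) y).
  rewrite -E integral_mkcond; apply: eq_integral => s _ /=.
  rewrite patchE; case: ifPn; rewrite ?inE ?notin_setE /= in_itv/= => s01.
    congr (mu _); apply/seteqP; split => x /=; rewrite /xsection/= inE/= ;
      by [case | ].
  rewrite (_ : xsection _ _ = set0) ?measure0//; apply/seteqP; split => x //=.
  by rewrite /xsection/= inE/= => -[].
apply: eq_integral => x _ /=; rewrite -lebesgue_unit_levels//.
congr (mu _); apply/seteqP; split => s /=; rewrite /ysection/= inE/= in_itv//=.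
Qed.

(** Once [F] and [G] have supremum 1, their superlevel sets are nonempty at every height in []0,
    1[], so Brunn-Minkowski applies at each height and integrates to an arithmetic mean. *)
Lemma prekopa_leindler1_normalized (t : R) (F G : RM -> R) (H : RM -> \bar R) :
  (0 < t < 1)%R -> measurable_fun setT F -> measurable_fun setT G ->
  measurable_fun setT H -> (forall x, 0 <= H x) ->
  (forall x, 0 <= F x <= 1)%R -> (forall x, 0 <= G x <= 1)%R ->
  (forall s, 0 < s < 1 -> exists x, s <= F x)%R ->
  (forall s, 0 < s < 1 -> exists x, s <= G x)%R ->
  (forall s x y, (0 < s < 1)%R -> (s <= F x)%R -> (s <= G y)%R ->
     s%:E <= H ((1 - t) * x + t * y)%R) ->
  (1 - t)%:E * \int[mu]_x (F x)%:E + t%:E * \int[mu]_x (G x)%:E <=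
    \int[mu]_x H x.
Proof.
move=> t01 mF mG mH H0 F01 G01 nF nG FGH.
have /andP[t0 t1] := t01.
have cake (E : RM -> R) : measurable_fun setT E ->
  (forall x, 0 <= E x <= 1)%R ->
    \int[mu]_x (E x)%:E = \int[mu]_(s in `]0%R, 1%R[) mu [set x : RM | (s <=
      E x)%R].
  move=> mE E01; have E0 x : 0 <= (E x)%:E by rewrite lee_fin;
    case/andP: (E01 x).
  have mE' : measurable_fun setT (EFin \o E) by exact/measurable_EFinP.
  rewrite (_ : (fun s : R => mu _) = fun s =>
    mu [set x : RM | s%:E <= (EFin \o E) x]).
    rewrite layer_cake//; apply: eq_integral => x _ /=.
    rewrite /mine; case: ifPn => //; rewrite -leNgt lee_fin => E1.
    by congr (_%:E); apply/le_anti; case/andP: (E01 x) => _ ->.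
  by apply/funext => s.
(* The layer-cake formula truncates at 1: harmless for [F] and [G], which are at most 1, and in the
   right direction for [H]. *)
apply: (@le_trans _ _ (\int[mu]_x mine (H x) 1)); last first.
  apply: ge0_le_integral => //.
  - by move=> x _; rewrite le_min H0 lee01.
  - by apply: measurable_mine.
  - by move=> x _; rewrite ge_min lexx.
rewrite !cake// -layer_cake//.
have mlev (E : RM -> R) : measurable_fun setT E ->
    measurable_fun (`]0%R, 1%R[ : set RM) (fun s : RM =>
      mu [set x : RM | (s <= E x)%R]).
  by move=> mE; exact: (@measurable_levels_measure (EFin \o E) (iffRL
    (measurable_EFinP _ _) mE)).
rewrite -!ge0_integralZl//; last 4 first.
- exact: mlev.
- by rewrite lee_fin ltW.
- exact: mlev.
- by rewrite lee_fin subr_ge0 ltW.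
rewrite -ge0_integralD//; last 4 first.
- by move=> s _; rewrite mule_ge0// lee_fin subr_ge0 ltW.
- by apply: measurable_funeM; exact: mlev.
- by move=> s _; rewrite mule_ge0// lee_fin ltW.
- by apply: measurable_funeM; exact: mlev.
have mlv (E : RM -> \bar R) (s : R) : measurable_fun setT E ->
    measurable [set x : RM | s%:E <= E x].
  by move=> mE; rewrite -[X in measurable X]setTI;
    exact: emeasurable_fun_c_infty.
have mlvR (E : RM -> R) (s : R) : measurable_fun setT E ->
    measurable [set x : RM | (s <= E x)%R].
  by move=> mE; apply: (mlv (EFin \o E)); exact/measurable_EFinP.
apply: ge0_le_integral => //.
- by move=> s _; rewrite adde_ge0// mule_ge0// lee_fin ?subr_ge0 ltW.
- by apply: emeasurable_funD; apply: measurable_funeM; exact: mlev.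
- exact: measurable_levels_measure.
- move=> s /=; rewrite in_itv/= => s01.
  apply: brunn_minkowski1 => //;
    [exact: mlvR|exact: mlvR|exact: mlv|exact: nF|exact: nG|].
  by move=> x y /=; exact: FGH.
Qed.

(** The integral of [f] is a supremum over simple functions below [f]; one of integral above [a],
    divided by its supremum [A], serves as [F]. *)
Lemma integral_gt_normalized (f : RM -> \bar R) (a : R) :
  (forall x, 0 <= f x) -> (0 < a)%R -> a%:E < \int[mu]_x f x ->
  exists (A : R) (F : RM -> R), [/\ (0 < A)%R, measurable_fun setT F,
    (forall x, 0 <= F x <= 1)%R /\ (forall s, 0 < s < 1 ->
      exists x, s <= F x)%R,
    forall x, (A * F x)%:E <= f x & (a / A)%:E <= \int[mu]_x (F x)%:E].
Proof.
move=> f0 a0; rewrite ge0_integralTE// => /ereal_sup_gt[_ [p /= pf <-]].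
rewrite -integralT_nnsfun => ap.
have pge0 x : (0 <= p x)%R by exact: fun_ge0.
have hsp : has_sup (range p).
  split; first by exists (p 0%R); exists 0%R.
  have [M [_ /(_ (M + 1)%R)]] := simple_bounded p.
  rewrite ltrDl ltr01 => /(_ isT) bM; exists (M + 1)%R => _ [x _ <-].
  exact: le_trans (ler_norm _) (bM x _).
pose A := sup (range p).
have pA x : (p x <= A)%R by apply: sup_upper_bound => //; exists x.
have A0 : (0 < A)%R.
  rewrite ltNge; apply/negP => A0; move: ap; rewrite (eq_integral (fun=> 0)).
    by rewrite integral0 lte_fin ltNge ltW.
  by move=> x _ /=; congr (_%:E); apply/le_anti; rewrite pge0 (le_trans (pA x)).
exists A, (fun x => A^-1 * p x)%R; split => //.
- exact: measurable_funM.
- split=> [x|s /andP[s0 s1]].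
    by rewrite mulr_ge0 ?invr_ge0 ?(ltW A0)//= ler_pdivrMl// mulr1.
  have [|_ [x _ <-] sx] := @sup_adherent _ (range p) (A - s * A) _ hsp.
    by rewrite subr_gt0 gtr_pMl.
  by exists x; rewrite ler_pdivlMl// mulrC ltW//; move: sx; rewrite -/A subKr.
- by move=> x; rewrite mulVKf ?gt_eqF//.
- under eq_integral do rewrite EFinM.
  rewrite ge0_integralZl_EFin//.
  + by rewrite mulrC EFinM lee_pmul2l ?lte_fin ?invr_gt0// ltW.
  + by move=> x _; rewrite lee_fin.
  + exact/measurable_EFinP.
  + by rewrite invr_ge0 ltW.
Qed.

(** The normalized inequality is applied to simple minorants of [f] and [g] divided by their suprema
    [A] and [B], and to [h] divided by the weighted geometric mean [C] of [A] and [B]. *)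
Lemma prekopa_leindler1 (t : R) (f g h : RM -> \bar R) : (0 < t < 1)%R ->
  measurable_fun setT h ->
  (forall x, 0 <= f x) -> (forall x, 0 <= g x) -> (forall x, 0 <= h x) ->
  (forall x y, geo_le t (f x) (g y) (h ((1 - t) * x + t * y)%R)) ->
  geo_le t (\int[mu]_x f x) (\int[mu]_x g x) (\int[mu]_x h x).
Proof.
move=> t01 mh f0 g0 h0 fgh; apply: geo_leW => a b a0 b0 af bg.
have [A [F [A0 mF [F01 nF] Ff aF]]] := integral_gt_normalized f0 a0 af.
have [B [G [B0 mG [G01 nG] Gg bG]]] := integral_gt_normalized g0 b0 bg.
pose C := (A `^ (1 - t) * B `^ t)%R.
have C0 : (0 < C)%R by rewrite mulr_gt0// powR_gt0.
have /andP[t0 t1] := t01.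
have := @prekopa_leindler1_normalized t F G (fun x => C^-1%:E * h x) t01 mF mG.
rewrite ge0_integralZl_EFin ?invr_ge0 ?(ltW C0)//.
move=> /(_ (measurable_funeM _ mh)) PL.
have {PL} : (1 - t)%:E * \int[mu]_x (F x)%:E + t%:E * \int[mu]_x (G x)%:E <=
    C^-1%:E * \int[mu]_x h x.
  apply: PL => //.
    by move=> x; rewrite mule_ge0// lee_fin invr_ge0 ltW.
  move=> s x y /andP[s0 s1] sF sG; rewrite lee_pdivlMl//.
  have := fgh x y (A * s)%R (B * s)%R; rewrite !mulr_gt0//.
  rewrite (_ : (A * s) `^ (1 - t) * (B * s) `^ t = C * s)%R; last first.
    rewrite !powRM ?ltW// mulrACA -powRD ?subrK ?powRr1 ?ltW//.
    by rewrite (gt_eqF s0)/= implybT.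
  rewrite -EFinM; apply => //.
    by apply: le_trans (Ff x); rewrite lee_fin ler_pM2l.
  by apply: le_trans (Gg y); rewrite lee_fin ler_pM2l.
rewrite lee_pdivlMl//; apply: le_trans.
(* The arithmetic mean of [a / A] and [b / B] dominates their geometric mean, whose product with [C]
   is the geometric mean of [a] and [b]. *)
apply: (@le_trans _ _ (C%:E * ((1 - t)%:E * (a / A)%:E + t%:E * (b / B)%:E))).
  rewrite -!EFinM lee_fin.
  have := @powR_amgm _ t (a / A) (b / B) t01;
    rewrite !divr_gt0// => /(_ isT isT).
  move=> /(ler_wpM2l (ltW C0)); apply: le_trans.
  rewrite /C mulrACA -!powRM ?divr_ge0 ?(ltW A0) ?(ltW B0) ?(ltW a0) ?(ltW
    b0)//.
  by rewrite (mulrC A) (mulrC B) !divfK ?gt_eqF.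
rewrite lee_pmul2l//; apply: leeD; rewrite lee_pmul2l// lte_fin//.
by rewrite subr_gt0.
Qed.

End prekopa_leindler1.

(** * The Prekopa-Leindler inequality in every dimension *)

Section prekopa_leindler.
Context {R : realType}.
Local Notation RM := (measurableTypeR R).

Definition tuple_conv d (t : R) (x y : d.-tuple RM) : d.-tuple RM :=
  [tuple (1 - t) * tnth x i + t * tnth y i | i < d].

Lemma tuple_conv_cons d (t a b : R) (x y : d.-tuple RM) :
  tuple_conv t (cons_pair (a, x)) (cons_pair (b, y)) =
  cons_pair ((1 - t) * a + t * b, tuple_conv t x y).
Proof.
apply: eq_from_tnth => i; rewrite tnth_mktuple.
by case: (unliftP ord0 i) => [j|] -> //=; rewrite !tnthS tnth_mktuple.
Qed.

Lemma integral_lebesgue_tupleS d (f : d.+1.-tuple RM -> \bar R) :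
  measurable_fun setT f -> (forall x, 0 <= f x)%E ->
  (\int[lebesgue_tuple d.+1]_x f x =
   \int[lebesgue_measure]_a \int[lebesgue_tuple d]_x f (cons_pair (a, x)))%E.
Proof.
move=> mf f0.
rewrite -[LHS]/(\int[pushforward (lebesgue_measure \x lebesgue_tuple d)
  (@cons_pair R d)]_x f x)%E.
rewrite ge0_integral_pushforward//; last exact: measurable_cons_pair.
rewrite preimage_setT fubini_tonelli1//.
  by apply: measurableT_comp => //; exact: measurable_cons_pair.
by move=> x; exact: f0.
Qed.

(** For fixed first coordinates the induction hypothesis compares the integrals over the remaining
    ones; this is the hypothesis of the one-dimensional case for the marginals. *)
Lemma prekopa_leindler d (t : R) (f g h : d.-tuple RM -> \bar R) : 0 < t < 1 ->
  measurable_fun setT f -> measurable_fun setT g -> measurable_fun setT h ->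
  (forall x, 0 <= f x)%E -> (forall x, 0 <= g x)%E -> (forall x, 0 <= h x)%E ->
  (forall x y, geo_le t (f x) (g y) (h (tuple_conv t x y))) ->
  geo_le t (\int[lebesgue_tuple d]_x f x)%E (\int[lebesgue_tuple d]_x g x)%E
    (\int[lebesgue_tuple d]_x h x)%E.
Proof.
move=> t01; elim: d f g h => [|d IHd] f g h mf mg mh f0 g0 h0 fgh.
  rewrite /= !integral_dirac// !diracE !in_setT !mul1e.
  by rewrite [X in h X](_ : _ = tuple_conv t [tuple] [tuple]) //;
    exact/esym/tuple0.
rewrite !integral_lebesgue_tupleS//.
have mc (k : d.+1.-tuple RM -> \bar R) : measurable_fun setT k ->
    measurable_fun setT (k \o @cons_pair R d).
  by move=> mk; apply: measurableT_comp => //; exact: measurable_cons_pair.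
have ms (k : d.+1.-tuple RM -> \bar R) (a : RM) : measurable_fun setT k ->
    measurable_fun setT (fun x => k (cons_pair (a, x))).
  by move=> mk; exact: (@measurable_fun_pair2 _ _ _ _ _ _ _ a (mc k mk)).
apply: prekopa_leindler1 => //.
- apply: (measurable_fun_fubini_tonelli_F (m2 := lebesgue_tuple d) (h \o
    @cons_pair R d)).
    exact: mc.
  by move=> p; exact: h0.
- by move=> a; exact: integral_ge0.
- by move=> a; exact: integral_ge0.
- by move=> a; exact: integral_ge0.
- move=> a b; apply: IHd => //; try exact: ms.
  by move=> x y; rewrite -tuple_conv_cons; exact: fgh.
Qed.

End prekopa_leindler.

(** * Maxima of Gumbel variables *)

Section exponential_race.
Context {R : realType}.

(* p s is the probability that an exponential clock of rate beta rings after
   time s and before an independent clock of rate alpha. *)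
Lemma exponential_race (p : R -> R) (alpha beta : R) : 0 <= alpha -> 0 < beta ->
  (forall s, 0 <= s -> 0 <= p s <= expR (- (beta * s))) ->
  (forall s dl, 0 <= s -> 0 < dl ->
    expR (- ((alpha + beta) * s)) * (expR (- (alpha * dl)) * (1 - expR (- (beta
      * dl))))
    <= p s - p (s + dl)
    <= expR (- ((alpha + beta) * s)) * (1 - expR (- (beta * dl)))) ->
  p 0 = beta / (alpha + beta).
Proof.
move=> alpha0 beta0 pbnd pdiff; set c := alpha + beta.
have c0 : 0 < c by rewrite /c ltr_wpDl.
have p01 : 0 <= p 0 <= 1.
  by have := pbnd _ (lexx 0); rewrite mulr0 oppr0 expR0.
(* A time grid of mesh [dl] determines [p 0] up to the factor [rho], which tends to 1 with [dl]
   tending to 0. *)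
have race (dl : R) : 0 < dl -> p 0 * expR (- (c * dl)) <= beta / c /\
    beta / c * expR (- (c * dl)) <= p 0.
  move=> dl0; set rho := expR (- (c * dl)).
  have rho0 : 0 < rho by exact: expR_gt0.
  have rho1 : rho < 1 by rewrite expR_lt1 oppr_lt0 mulr_gt0.
  pose u := 1 - expR (- (beta * dl)).
  pose l := expR (- (alpha * dl)) * u.
  have u0 : 0 < u by rewrite subr_gt0 expR_lt1 oppr_lt0 mulr_gt0.
  have rhoN (N : nat) : expR (- (c * (N%:R * dl))) = rho ^+ N.
    by rewrite -expRM_natl; congr expR; ring.
  (* The decrease of [p] over the [j]-th grid interval, counted from 0, lies between [l * rho ^+ j]
     and [u * rho ^+ j]; this is the telescoped sum, multiplied by [1 - rho]. *)
  have sums (N : nat) : l * (1 - rho ^+ N) <=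
    (1 - rho) * (p 0 - p (N%:R * dl)) <=
      u * (1 - rho ^+ N).
    elim: N => [|N /andP[IHl IHu]];
      first by rewrite mul0r expr0 !subrr !mulr0 lexx.
    have Ndl0 : 0 <= N%:R * dl by rewrite mulr_ge0// ltW.
    have := pdiff _ _ Ndl0 dl0; rewrite rhoN -/u -/l => /andP[dl1 dl2].
    have -> : N.+1%:R * dl = N%:R * dl + dl by rewrite -natr1 mulrDl mul1r.
    have r1 : 0 < 1 - rho by rewrite subr_gt0.
    have := ler_wpM2l (ltW r1) dl1;
      have := ler_wpM2l (ltW r1) dl2 => {}dl2 {}dl1.
    by rewrite exprS; apply/andP; split; nra.
  have cvg0 (x : R) : 0 < x < 1 -> x ^+ n @[n --> \oo] --> 0.
    by move=> /andP[x0 x1]; apply: cvg_expr; rewrite ger0_norm// ltW.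
  (* Limit in [N]: the remainder [p (N%:R * dl)] is bounded by a vanishing geometric sequence. For
     the lower bound below, its nonnegativity is enough. *)
  have ule : (1 - rho) * p 0 <= u.
    have x01 : 0 < expR (- (beta * dl)) < 1 by rewrite expR_gt0 -subr_gt0.
    have bnd (N : nat) : (1 - rho) * p 0 - u <= expR (- (beta * dl)) ^+ N.
      have /andP[_] := sums N.
      have Ndl0 : 0 <= N%:R * dl by rewrite mulr_ge0// ltW.
      have := pbnd _ Ndl0; rewrite (_ : - (beta * (N%:R * dl)) =
        N%:R * (- (beta * dl))); last by ring.
      rewrite expRM_natl => /andP[_ pN] sN.
      have rN0 : 0 <= rho ^+ N by rewrite exprn_ge0 ?ltW.
      have xN0 : 0 <= expR (- (beta * dl)) ^+ N by rewrite exprn_ge0 ?expR_ge0.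
      by nra.
    rewrite -subr_le0; apply: (ler_cvg_to (cvg_cst _) (cvg0 _ x01)).
    by near=> n; exact: bnd.
  have lle : l <= (1 - rho) * p 0.
    have rho01 : 0 < rho < 1 by rewrite rho0.
    have bnd (N : nat) : l - (1 - rho) * p 0 <= l * rho ^+ N.
      have /andP[+ _] := sums N.
      have Ndl0 : 0 <= N%:R * dl by rewrite mulr_ge0// ltW.
      have /andP[pN _] := pbnd _ Ndl0.
      by nra.
    have cl : l * rho ^+ n @[n --> \oo] --> 0.
      by rewrite -[X in _ --> X](mulr0 l); apply: cvgMr; exact: cvg0.
    rewrite -subr_le0; apply: (ler_cvg_to (cvg_cst _) cl).
    by near=> n; exact: bnd.
  have expN (x : R) : expR (- x) * x <= 1 - expR (- x) <= x.
    apply/andP; split.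
      rewrite -(ler_pM2l (expR_gt0 x)) mulrA mulrBr expRxMexpNx_1 mul1r mulr1.
      by have := expR_ge1Dx x; lra.
    by have := expR_ge1Dx (- x); lra.
  have /andP[crho1 crho2] := expN (c * dl).
  have /andP[cb1 cb2] := expN (beta * dl).
  have lE : rho = expR (- (alpha * dl)) * expR (- (beta * dl)).
    by rewrite -expRD; congr expR; rewrite /c; ring.
  have p00 : 0 <= p 0 by case/andP: p01.
  split.
    rewrite ler_pdivlMr// -(ler_pM2r dl0).
    by have := ler_wpM2l p00 crho1; move: ule cb2; rewrite -/rho -/u; lra.
  rewrite mulrAC ler_pdivrMr// -(ler_pM2r dl0).
  have le1 := ler_wpM2l (expR_ge0 (- (alpha * dl))) cb1; rewrite -/u -/l in le1.
  have lE' : expR (- (alpha * dl)) * (expR (- (beta * dl)) * (beta * dl)) =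
    rho * (beta * dl).
    by rewrite lE mulrA.
  rewrite lE' in le1.
  by have := ler_wpM2l p00 crho2; move: lle; rewrite -/rho; lra.
apply/eqP; rewrite eq_le; apply/andP; split; apply/ler_addgt0Pr => e e0.
(* With mesh [e / c] the factor is [expR (- e)], at least [1 - e]; as [p 0] and [beta / c] are at
   most 1, the error is at most [e]. *)
- have dl0 : 0 < e / c by rewrite divr_gt0.
  have [+ _] := race _ dl0; have := expR_ge1Dx (- (c * (e / c))).
  rewrite mulrC divfK ?gt_eqF// => h1 h2.
  by case/andP: p01 => p0 p1; nra.
- have dl0 : 0 < e / c by rewrite divr_gt0.
  have [_ +] := race _ dl0; have := expR_ge1Dx (- (c * (e / c))).
  rewrite mulrC divfK ?gt_eqF// => h1 h2.
  have r0 : 0 <= beta / c by rewrite divr_ge0 ?ltW.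
  have r1 : beta / c <= 1 by rewrite ler_pdivrMr// mul1r /c lerDr.
  by case/andP: p01 => p0 p1; nra.
Unshelve. all: by end_near. Qed.

End exponential_race.

(** * The race between Gumbel shocks *)

Section gumbel_max.
Context {R : realType} {dO : measure_display} {Omega : measurableType dO}.
Variable P : probability Omega R.

Lemma fine_probability_setD (A B : set Omega) : measurable A -> measurable B ->
  A `<=` B -> fine (P (B `\` A)) = fine (P B) - fine (P A).
Proof.
move=> mA mB AB; rewrite measureD//=; last by rewrite ltey_eq fin_num_measure.
by rewrite (setIidr AB) fineB ?fin_num_measure.
Qed.

Lemma le_fine_probability (A B : set Omega) : measurable A -> measurable B ->
  A `<=` B -> fine (P A) <= fine (P B).
Proof.
by move=> mA mB AB; rewrite fine_le ?fin_num_measure// le_measure ?inE.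
Qed.

(** If [z] is standard Gumbel, then [expR (- (c + z))] is exponential of rate [expR c]. *)
Lemma gumbel_tail (e : {RV P >-> R}) (c s : R) : std_gumbel e -> 0 <= s ->
  P (e @^-1` [set z | s <= expR (- (c + z))]) = (expR (- (s * expR c)))%:E.
Proof.
move=> eG; rewrite le_eqVlt => /predU1P[<-|s0].
  rewrite mul0r oppr0 expR0 (_ : _ @^-1` _ = setT) ?probability_setT//.
  by apply/seteqP; split => // w _ /=; exact: expR_ge0.
have := eG (- ln s - c); rewrite /cdf /distribution /pushforward.
rewrite opprB opprK expRD lnK ?posrE// mulrC => <-; congr (P _).
apply/seteqP; split => w /=; rewrite in_itv/=.
  by rewrite -ler_ln ?posrE ?expR_gt0// expRK => h; lra.
by move=> h; rewrite -ler_ln ?posrE ?expR_gt0// expRK; lra.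
Qed.

(** [exponential_race] is applied to the probability that clock [b] wins and rings no earlier than
    [s], with [alpha] the total rate of its competitors. *)
Lemma gumbel_max (T : finType) (e : T -> {RV P >-> R}) (c : T -> R) (b : T) :
  (forall B : T -> set R, (forall a, measurable (B a)) ->
    P (\bigcap_(a in [set: T]) (e a @^-1` B a)) =
      (\prod_a P (e a @^-1` B a))%E) ->
  (forall a, std_gumbel (e a)) ->
  fine (P [set w | forall a, c a + e a w <= c b + e b w]) =
  expR (c b) / \sum_a expR (c a).
Proof.
move=> indep eG.
pose Z a w := expR (- (c a + e a w)).
(* Ties count as wins of [b]. The events [J] have product probabilities, and their differences
   sandwich those of [D]. *)
pose D s := [set w | (forall a, Z b w <= Z a w) /\ s <= Z b w].
pose J s u := [set w | s <= Z b w /\ forall a, a != b -> u <= Z a w].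
have mZ a : measurable_fun setT (Z a).
  apply: measurableT_comp => //; apply: measurableT_comp => //.
  exact: measurable_funD.
have mle (f g : Omega -> R) : measurable_fun setT f -> measurable_fun setT g ->
    measurable [set w | f w <= g w].
  by move=> mf mg; rewrite -[X in measurable X]setTI; apply: measurable_fun_le.
have mall (Q : pred T) (f g : T -> Omega -> R) :
    (forall a, measurable_fun setT (f a)) ->
      (forall a, measurable_fun setT (g a)) ->
    measurable [set w | forall a, Q a -> f a w <= g a w].
  move=> mf mg; rewrite (_ : mkset _ =
    \bigcap_(a in [set a | Q a]) [set w | f a w <= g a w]).
    by apply: fin_bigcap_measurable => // a _; exact: mle.
  by apply/seteqP; split => w h a; exact: h.
have mD s : measurable (D s).
  rewrite (_ : D s = [set w | forall a, predT a ->
    Z b w <= Z a w] `&` [set w | s <= Z b w]).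
    by apply: measurableI; [exact: mall|exact: mle].
  by apply/seteqP; split => w [h1 h2]; split => // a *; exact: h1.
have mJ s u : measurable (J s u).
  by apply: measurableI; [exact: mle|exact: mall].
pose alpha := \sum_(a | a != b) expR (c a).
pose beta := expR (c b).
have PJ s u : 0 <= s -> 0 <= u ->
  fine (P (J s u)) = expR (- (s * beta + u * alpha)).
  move=> s0 u0.
  pose r a := if a == b then s else u.
  have r0 a : 0 <= r a by rewrite /r; case: ifP.
  pose B a := [set z | r a <= expR (- (c a + z))].
  have mB a : measurable (B a).
    rewrite -[X in measurable X]setTI; apply: measurable_fun_le => //.
    by apply: measurableT_comp => //; apply: measurableT_comp => //;
      exact: measurable_funD.
  rewrite (_ : J s u = \bigcap_(a in [set: T]) (e a @^-1` B a)).
    rewrite indep//.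
    under eq_bigr do rewrite gumbel_tail//.
    rewrite prodEFin/= -expR_sum; congr expR.
    rewrite sumrN; congr (- _); rewrite (bigD1 b)//= /r eqxx; congr (_ + _).
    by rewrite mulr_sumr; apply: eq_bigr => a /negPf ->.
  apply/seteqP; split => [w [h1 h2] a _|w h] /=.
    by rewrite /B /r /=; case: (eqVneq a b) => [->//|ab]; exact: h2.
  split=> [|a ab]; first by have := h b Logic.I; rewrite /B /r /= eqxx.
  by have := h a Logic.I; rewrite /B /r /= (negPf ab).
have PJD s s' u : 0 <= s -> s <= s' -> 0 <= u ->
    fine (P (J s u `\` J s' u)) =
      expR (- (u * alpha)) * (expR (- (s * beta)) - expR (- (s' * beta))).
  move=> s0 ss' u0; rewrite fine_probability_setD//; last first.
    by move=> w [h1 h2]; split => //; exact: le_trans h1.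
  rewrite !PJ//; last exact: le_trans ss'.
  by rewrite !opprD !expRD; ring.
have -> : [set w | forall a, c a + e a w <= c b + e b w] = D 0.
  apply/seteqP; split => w /=.
    by move=> h; split => [a|]; [rewrite /Z ler_expR lerN2|exact: expR_ge0].
  by move=> [h _] a; have := h a; rewrite /Z ler_expR lerN2.
rewrite (@exponential_race _ (fun s => fine (P (D s))) alpha beta).
- by rewrite /alpha /beta [in RHS](bigD1 b)//= addrC.
- by apply: sumr_ge0 => a _; exact: expR_ge0.
- exact: expR_gt0.
- move=> s s0; rewrite fine_ge0//=.
  have := PJ s 0 s0 (lexx _); rewrite mul0r addr0 (mulrC beta) => <-.
  apply: le_fine_probability => // w [_ h]; split => // a _; exact: expR_ge0.
- move=> s dl s0 dl0.
  have ss' : s <= s + dl by rewrite lerDl ltW.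
  have s'0 : 0 <= s + dl by exact: le_trans ss'.
  rewrite -fine_probability_setD//; last first.
    by move=> w [h1 h2]; split => //; exact: le_trans h2.
  have mDD : measurable (D s `\` D (s + dl)) by exact: measurableD.
  apply/andP; split.
    (* Clock [b] surely wins if it rings in [[s, s + dl[] and all others at [s + dl] or later. *)
    have -> : expR (- ((alpha + beta) * s)) * (expR (- (alpha * dl)) * (1 -
      expR (- (beta * dl)))) =
        fine (P (J s (s + dl) `\` J (s + dl) (s + dl))).
      rewrite PJD// !mulrBr mulr1 -!expRD.
      by congr (expR _ - expR _); ring.
    apply: le_fine_probability => //; first exact: measurableD.
    move=> w [[h1 h2] h3].
    have Zb : Z b w < s + dl by rewrite ltNge; apply/negP => h; exact: h3.
    split; last by move=> [_]; rewrite leNgt Zb.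
    split => // a; have [->//|ab] := eqVneq a b.
    exact: le_trans (ltW Zb) (h2 a ab).
  (* Conversely, if [b] wins by ringing in [[s, s + dl[], then all others ring at [s] or later. *)
  have -> : expR (- ((alpha + beta) * s)) * (1 - expR (- (beta * dl))) =
      fine (P (J s s `\` J (s + dl) s)).
    rewrite PJD// !mulrBr mulr1 -!expRD.
    by congr (expR _ - expR _); ring.
  apply: le_fine_probability => //; first exact: measurableD.
  move=> w [[h1 h2] h3]; split.
    by split => // a _; exact: le_trans h2 (h1 a).
  by move=> [h4 _]; apply: h3; split.
Qed.

End gumbel_max.

(** * Log-concavity and conditioning *)

Section log_concave_real.
Context {R : realType}.
Implicit Types (t : R).

(** [geo_le] tests only positive [a] and [b]; if [u] or [v] is zero, so is the geometric mean, both
    exponents being positive. *)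
Lemma geo_le_EFin t (u v w : R) : 0 < t < 1 -> 0 <= u -> 0 <= v -> 0 <= w ->
  geo_le t u%:E v%:E w%:E <-> u `^ (1 - t) * v `^ t <= w.
Proof.
move=> /andP[t0 t1] u0 v0 w0; have s0 : 0 < 1 - t by rewrite subr_gt0.
split=> [|uvw a b a0 b0]; last first.
  rewrite !lee_fin => au bv; apply: le_trans uvw.
  by apply: ler_pM; rewrite ?powR_ge0// ge0_ler_powR ?nnegrE ?(ltW a0) ?(ltW
    b0) ?(ltW t0) ?(ltW s0).
move: u0 v0; rewrite le_eqVlt => /predU1P[<-|u0].
  by rewrite powR0 ?gt_eqF// mul0r.
rewrite le_eqVlt => /predU1P[<-|v0].
  by rewrite powR0 ?gt_eqF// mulr0.
by move=> /(_ u v u0 v0); rewrite !lee_fin !lexx => /(_ isT isT).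
Qed.

(* equivalent to the convexity of log-sum-exp *)
Lemma softmax_log_concave (T : finType) t (u v w : T ->
  R) (b : T) : 0 < t < 1 ->
  (forall a, w a = (1 - t) * u a + t * v a) ->
  (expR (u b) / \sum_a expR (u a)) `^ (1 - t) * (expR (v b) / \sum_a expR (v
    a)) `^ t
  <= expR (w b) / \sum_a expR (w a).
Proof.
move=> t01 wE.
have sum0 (f : T -> R) : 0 < \sum_a expR (f a).
  by rewrite (bigD1 b)//= ltr_pwDl ?expR_gt0// sumr_ge0// => a _;
    exact: expR_ge0.
set U := \sum_a expR (u a); set V := \sum_a expR (v a).
have U0 : 0 < U by exact: sum0.
have V0 : 0 < V by exact: sum0.
(* The geometric mean of the two softmax vectors is [expR (w a)] up to a factor independent of [a],
   so only the normalizing constants remain to be compared. *)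
have q (a : T) : (expR (u a) / U) `^ (1 - t) * (expR (v a) / V) `^ t =
    expR (w a) / (U `^ (1 - t) * V `^ t).
  rewrite !powRM ?expR_ge0 ?invr_ge0 ?(ltW U0) ?(ltW V0)// mulrACA -!expRM
    -expRD.
  rewrite (mulrC (u a)) (mulrC (v a)) -wE.
  have inv (x s : R) : 0 < x -> x^-1 `^ s = (x `^ s)^-1.
    by move=> x0; rewrite -[x^-1]powR_inv1 ?ltW// -powRrM mulN1r powRN.
  by rewrite !inv// invfM.
rewrite q ler_pM2l ?expR_gt0// lef_pV2 ?posrE ?sum0//; last first.
  by rewrite mulr_gt0 ?powR_gt0.
have C0 : 0 < U `^ (1 - t) * V `^ t by rewrite mulr_gt0 ?powR_gt0.
(* This is Hölder's inequality: the geometric mean of two probability vectors has total mass at most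
   1, by AM-GM in each coordinate. *)
rewrite -[leRHS]mul1r -ler_pdivrMr// mulr_suml.
rewrite (eq_bigr _ (fun a _ => esym (q a))).
apply: (@le_trans _ _ (\sum_a ((1 - t) * (expR (u a) / U) + t * (expR (v a) /
  V)))).
  by apply: ler_sum => a _; rewrite powR_amgm// divr_gt0 ?expR_gt0.
rewrite big_split/= -!mulr_sumr -!mulr_suml !divff ?gt_eqF//.
by rewrite !mulr1 subrK.
Qed.

Lemma prod_powR_le (I : finType) t (u v w : I -> R) :
  (forall i, [/\ 0 <= u i, 0 <= v i, 0 <= w i & u i `^ (1 - t) * v i `^ t <=
    w i]) ->
  (\prod_i u i) `^ (1 - t) * (\prod_i v i) `^ t <= \prod_i w i.
Proof.
move=> uvw.
suff [] : [/\ 0 <= \prod_i u i, 0 <= \prod_i v i, 0 <= \prod_i w i &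
  (\prod_i u i) `^ (1 - t) * (\prod_i v i) `^ t <= \prod_i w i] by [].
elim/big_rec3: _ => [|i p1 p2 p3 _ [p10 p20 p30 H]].
  by rewrite !powR1 mulr1 !ler01; split.
have [u0 v0 w0 Hi] := uvw i; split; rewrite ?mulr_ge0//.
by rewrite !powRM// mulrACA ler_pM// mulr_ge0 ?powR_ge0.
Qed.

End log_concave_real.

(** * Conditioning on an independent variable with a density *)

Section disintegration.
Context {R : realType} {dO d1 d2 : measure_display} {Omega : measurableType dO}
  {T1 : measurableType d1} {T2 : measurableType d2}.
Variables (P : probability Omega R) (X : {RV P >-> T1}) (W : {RV P >-> T2}).
Variables (nu : {sigma_finite_measure set T1 -> \bar R}) (f : T1 -> R).
Hypotheses (mf : measurable_fun setT f) (f0 : forall x, 0 <= f x).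
Hypothesis X_density : forall B, measurable B ->
  distribution P X B = (\int[nu]_(x in B) (f x)%:E)%E.
Hypothesis XW : forall A B, measurable A -> measurable B ->
  P (X @^-1` A `&` W @^-1` B) = (P (X @^-1` A) * P (W @^-1` B))%E.

(** By independence the joint law is the product of the marginals; the law of [X] is replaced by its
    density on sections of [N], and Tonelli exchanges the integrals. *)
Lemma independent_density_integral (N : set (T1 * T2)) : measurable N ->
  P [set w | N (X w, W w)] =
  (\int[nu]_x (P [set w | N (x, W w)] * (f x)%:E))%E.
Proof.
move=> mN.
have mXW : measurable_fun setT (fun w =>
  (X w, W w)) by exact: measurable_fun_pair.
rewrite -[LHS]/(measure_function_pushforward__canonical__measure_function_Measure P mXW N).
transitivity ((distribution P X \x distribution P W)%E N).
  by apply/esym/product_measure_unique => // A B mA mB; exact: XW.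
(* In this order of integration the inner measure is the law of [X], where the density can be
   inserted. *)
transitivity ((distribution P X \x^ distribution P W)%E N).
  by apply: product_measure_unique => // A B mA mB; exact: product_measure2E.
have mu_indic (x : T1) (w : T2) : \1_N (x, w) = \1_(ysection N w) x :> R.
  by rewrite !indicE mem_ysection.
pose F (p : T1 * T2) := ((f p.1)%:E * (\1_N p)%:E)%E.
have mF : measurable_fun setT F.
  apply: emeasurable_funM; apply/measurable_EFinP.
    exact: measurableT_comp.
  exact: measurable_indic.
have F0 p : (0 <= F p)%E by rewrite /F mule_ge0 ?lee_fin.
transitivity (\int[distribution P W]_w \int[nu]_x F (x, w))%E; last first.
  rewrite -(@fubini_tonelli _ _ _ _ _ nu (distribution P W) F mF F0).
  apply: eq_integral => x _; rewrite /F /=.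
  rewrite ge0_integralZl_EFin//.
  - rewrite muleC; congr (_ * _)%E.
    rewrite (_ : (fun w => _) = EFin \o \1_(xsection N x)); last first.
      by apply/funext => w; rewrite /= !indicE mem_xsection.
    rewrite integral_indic//; last exact: measurable_xsection.
    rewrite setIT /= /distribution /pushforward; congr (P _).
    by apply/seteqP; split => w /=; rewrite /xsection/= inE.
  - by apply/measurable_EFinP; apply: (measurable_fun_pair2 x);
      exact: measurable_indic.
rewrite -[LHS]/(\int[distribution P W]_w distribution P X (ysection N w))%E.
apply: eq_integral => w _; rewrite X_density; last exact: measurable_ysection.
rewrite integral_mkcond; apply: eq_integral => x' _.
rewrite patchE /F /= mu_indic indicE; case: ifPn => _; rewrite ?mule1 ?mule0//.
Qed.

End disintegration.

(** * The game *)

(** Serves on [Omega], on [Omega] with a generated sigma-algebra, and on the product of the latter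
    with the space of common shocks. *)
Lemma measurable_argmax {R : realType} d (T : measurableType d) (F : finType)
    (f : F -> T -> R) (b : F) : (forall a, measurable_fun setT (f a)) ->
  measurable [set w | forall a, f a w <= f b w].
Proof.
move=> mf; rewrite (_ : mkset _ =
  \bigcap_(a in [set: F]) [set w | f a w <= f b w]).
  apply: fin_bigcap_measurable => // a _.
  by rewrite -[X in measurable X]setTI; apply: measurable_fun_le.
by apply/seteqP; split => w h a => [_|]; exact: h.
Qed.

Section payoffs.
Context {R : realType} {n : nat} {Y : 'I_n -> finType}.
Context {X Sigma : Type} {k d : nat}.
Variables (v : 'cV[R]_k -> forall i : 'I_n, profile Y -> X -> R)
          (S : Sigma -> forall i : 'I_n, 'M[R]_(#|Y i|, d)).

Lemma measurable_Vpayoff (g : 'cV[R]_k) (s : Sigma) (i : 'I_n) (a : Y i)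
    (y : profile Y) (x : X) :
  measurable_fun setT
    (fun t : d.-tuple (measurableTypeR R) => Vpayoff v S g s a y x (colv t)).
Proof.
apply: measurable_funD => //.
under eq_fun do rewrite mxE.
apply: measurable_sum => j; apply: measurable_funM => //.
by under eq_fun do rewrite mxE; exact: measurable_tnth.
Qed.

(** [S] depends on [s] alone, so no term mixes the parameter with the common shock, and the payoff
    is jointly affine in the two. *)
Lemma Vpayoff_conv (Gamma : set 'cV[R]_k) (t : R) (ga gb : 'cV[R]_k)
    (s : Sigma) (i : 'I_n) (a : Y i) (y : profile Y) (x : X) (l m : 'cV[R]_d) :
  (forall i y x, affine_on Gamma (fun g => v g i y x)) ->
  Gamma ga -> Gamma gb -> Gamma ((1 - t) *: ga + t *: gb) ->
  Vpayoff v S ((1 - t) *: ga + t *: gb) s a y x ((1 - t) *: l + t *: m) =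
  (1 - t) * Vpayoff v S ga s a y x l + t * Vpayoff v S gb s a y x m.
Proof.
move=> v_affine Ga Gb Gc; have [c [b vE]] := v_affine i (deviate y a) x.
rewrite /Vpayoff !vE// mulmxDr -!scalemxAr !mxE.
have -> : \sum_(j < k) c j ord0 * ((1 - t) *: ga + t *: gb) j ord0 =
    (1 - t) * (\sum_(j < k) c j ord0 * ga j ord0) +
    t * (\sum_(j < k) c j ord0 * gb j ord0).
  by rewrite !mulr_sumr -big_split/=; apply: eq_bigr => j _; rewrite !mxE; ring.
ring.
Qed.

Definition logit_likelihood (g : 'cV[R]_k) (s : Sigma) (y : profile Y) (x : X)
    (l : 'cV[R]_d) : R :=
  \prod_(i < n) (expR (Vpayoff v S g s (y i) y x l) /
    \sum_(a : Y i) expR (Vpayoff v S g s a y x l)).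

Lemma logit_ge0 (i : 'I_n) (g : 'cV[R]_k) (s : Sigma) (y : profile Y) (x : X)
    (l : 'cV[R]_d) :
  0 <= expR (Vpayoff v S g s (y i) y x l) /
    \sum_(a : Y i) expR (Vpayoff v S g s a y x l).
Proof. by rewrite divr_ge0 ?expR_ge0// sumr_ge0// => a _; exact: expR_ge0. Qed.

Lemma logit_likelihood_ge0 (g : 'cV[R]_k) (s : Sigma) (y : profile Y) (x : X)
    (l : 'cV[R]_d) : 0 <= logit_likelihood g s y x l.
Proof. by apply: prodr_ge0 => i _; exact: logit_ge0. Qed.

Lemma measurable_logit_likelihood (g : 'cV[R]_k) (s : Sigma) (y : profile Y) (x
  : X) :
  measurable_fun setT
    (fun t : d.-tuple (measurableTypeR R) => logit_likelihood g s y x (colv t)).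
Proof.
apply: measurable_prod => i _.
(* The inverse of the nonnegative sum is written as its power -1, to use the measurability of real
   powers. *)
rewrite (_ : (fun _ => _) = fun t : d.-tuple (measurableTypeR R) =>
    expR (Vpayoff v S g s (y i) y x (colv t)) *
    (\sum_(a : Y i) expR (Vpayoff v S g s a y x (colv t))) `^ (-1)); last first.
  apply/funext => t; rewrite powR_inv1// sumr_ge0// => a _; exact: expR_ge0.
apply: measurable_funM.
  by apply: measurableT_comp => //; exact: measurable_Vpayoff.
apply: (@measurableT_comp _ _ _ _ _ _ (fun z : R => z `^ (-1)));
  first exact: measurable_powR.
apply: measurable_sum => a; apply: measurableT_comp => //;
  exact: measurable_Vpayoff.
Qed.

Lemma logit_likelihood_log_concave (Gamma : set 'cV[R]_k) (t : R)
    (ga gb : 'cV[R]_k) (s : Sigma) (y : profile Y) (x : X) (l m : 'cV[R]_d) :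
  (forall i y x, affine_on Gamma (fun g => v g i y x)) -> 0 < t < 1 ->
  Gamma ga -> Gamma gb -> Gamma ((1 - t) *: ga + t *: gb) ->
  logit_likelihood ga s y x l `^ (1 - t) * logit_likelihood gb s y x m `^ t <=
  logit_likelihood ((1 - t) *: ga + t *: gb) s y x ((1 - t) *: l + t *: m).
Proof.
move=> v_affine t01 Ga Gb Gc; apply: prod_powR_le => i; split;
  try exact: logit_ge0.
apply: (softmax_log_concave (y i) t01) => a; exact: (@Vpayoff_conv Gamma).
Qed.

Lemma colv_tuple_conv (t : R) (p q : d.-tuple (measurableTypeR R)) :
  colv (tuple_conv t p q) = (1 - t) *: colv p + t *: colv q.
Proof. by apply/colP => i; rewrite !mxE tnth_mktuple. Qed.

(** * Choice probabilities and likelihoods under independent shocks *)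

Section shocks.
Context {dO : measure_display} {Omega : measurableType dO}.
Variables (P : probability Omega R) (eps : forall i : 'I_n, Y i ->
  {RV P >-> R}).

(** Independence of the family of all scalar shocks is restricted to the index set [K] of player
    [i], which puts it in the form required by [gumbel_max]. *)
Lemma best_response_prob_logit (i : 'I_n) (b : Y i) (y : profile Y) (x : X)
    (l : 'cV[R]_d) (g : 'cV[R]_k) (s : Sigma) :
  mutually_independent P (scalar_shock_events eps) ->
  (forall i a, std_gumbel (@eps i a)) ->
  best_response_prob v S eps g s b y x l =
  expR (Vpayoff v S g s b y x l) / \sum_(a : Y i) expR (Vpayoff v S g s a y x
    l).
Proof.
move=> indep eG; apply: (@gumbel_max _ _ _ P (Y i) (@eps i)) => // B mB.
pose K := [set Tagged Y a | a : Y i]%SET.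
(* An event is needed at every index: [tagged_as] recovers the action when [j] belongs to player [i]
   and defaults to [b] otherwise, outside [K]. *)
pose A (j : {i : 'I_n & Y i}) := eps (tagged j) @^-1` B (tagged_as (Tagged Y b)
  j).
have FA j : scalar_shock_events eps j (A j).
  by exists (B (tagged_as (Tagged Y b) j)) => //; rewrite setTI.
have AE a : A (Tagged Y a) = eps a @^-1` B a.
  by rewrite /A (@tagged_asE _ _ (Tagged Y b) a).
have := indep K A FA.
rewrite big_imset/=; last first.
  by move=> a a' _ _ /eqP; rewrite -tag_eqE /tag_eq /= eqxx tagged_asE => /eqP.
rewrite (_ : \bigcap_(j in [set` K]) A j =
  \bigcap_(a in [set: Y i]) (eps a @^-1` B a)).
  by move=> ->; apply: eq_big => // a _; rewrite AE.
apply/seteqP; split => w h => [a _|_ /= /imsetP[a _ ->]]; last first.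
  by rewrite AE; exact: h.
by rewrite -AE; apply: h => /=; exact: imset_f.
Qed.

Lemma measurable_shock (i : 'I_n) (a : Y i) (G : set (set Omega)) :
  rv_events (eps a) `<=` <<s G >> ->
  measurable_fun setT (eps a : g_sigma_algebraType G -> R).
Proof.
move=> eG _ B mB; apply: eG; exists B => //.
Qed.

Lemma measurable_best_response (i : 'I_n) (b : Y i) (y : profile Y) (x : X)
    (l : 'cV[R]_d) (g : 'cV[R]_k) (s : Sigma) :
  measurable [set w | best_response v S g s b y x l (fun a => eps a w)].
Proof.
apply: (@measurable_argmax R _ _ (Y i) (fun a w =>
  Vpayoff v S g s a y x l + eps a w) b) => a.
exact: measurable_funD.
Qed.

Lemma measurable_equilibria (y : profile Y) (x : X)
    (l : 'cV[R]_d) (g : 'cV[R]_k) (s : Sigma) :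
  measurable [set w | equilibria v S g s x l (fun i (a : Y i) => eps a w) y].
Proof.
rewrite (_ : mkset _ = \bigcap_(i in [set: 'I_n])
    [set w | best_response v S g s (y i) y x l (fun a => eps a w)]).
  by apply: fin_bigcap_measurable => // i _; exact: measurable_best_response.
by apply/seteqP; split => w h i => [_|]; exact: h.
Qed.

(** With the common shock fixed, equilibrium is the intersection over players of events that depend
    each on one player's own shocks. *)
Lemma likelihood_given_prod (d' : measure_display) (T : measurableType d')
  (lam : {RV P >-> T}) (y : profile Y) (x : X)
    (l : 'cV[R]_d) (g : 'cV[R]_k) (s : Sigma) :
  mutually_independent P (all_shock_events eps lam) ->
  likelihood_given v S eps g s y x l =
  \prod_(i < n) best_response_prob v S eps g s (y i) y x l.
Proof.
move=> indep.
pose A (o : option 'I_n) : set Omega :=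
  if o is Some i then [set w | best_response v S g s (y i) y x l (fun a =>
    eps a w)]
  else setT.
have FA o : all_shock_events eps lam o (A o).
  case: o => [i|]; last by exists setT => //; rewrite setTI.
  rewrite /= /player_shock_events /joint_events.
  set G := \bigcup_j _.
  (* Independence requires membership in the sigma-algebra generated by the shocks of player [i], so
     measurability is checked there and not merely on [Omega]. *)
  apply: (@measurable_argmax R _ (g_sigma_algebraType G) (Y i)
    (fun a w => Vpayoff v S g s a y x l + eps a w) (y i)) => a.
  apply: measurable_funD => //; apply: measurable_shock => B eB.
  by apply: sub_sigma_algebra; exists a.
have := indep [set Some i | i : 'I_n]%SET A FA.
rewrite big_imset/=; last by move=> ? ? _ _ [].
rewrite (_ : \bigcap_(j in [set` _]) A j =
    [set w | equilibria v S g s x l (fun i (a : Y i) => eps a w) y]).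
  move=> PE; apply: EFin_inj;
    rewrite /likelihood_given fineK ?fin_num_measure//.
    rewrite PE -prodEFin; apply: eq_bigr => i _.
    by rewrite /best_response_prob fineK// fin_num_measure//;
      exact: measurable_best_response.
  exact: measurable_equilibria.
apply/seteqP; split => w h => [i|_ /= /imsetP[i _ ->]]; last exact: h.
by apply: (h (Some i)) => /=; exact: imset_f.
Qed.

(* The shocks enter only through the sigma-algebra they generate: Omega itself,
   equipped with it, serves as the space of shock realisations. *)
Lemma likelihood_integral (lam : {RV P >-> d.-tuple (measurableTypeR R)})
    (dX : measure_display) (XT : measurableType dX) (xi : {RV P >-> XT})
    (h : 'cV[R]_d -> R) (y : profile Y) (x : X) (g : 'cV[R]_k) (s : Sigma) :
  has_lebesgue_density lam h ->
  independent2 P (joint_events (scalar_shock_events eps))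
    (rv_events (fun w => (xi w, lam w))) ->
  (likelihood v S eps (colv \o lam) g s y x)%:E =
  (\int[lebesgue_tuple d]_t
     (likelihood_given v S eps g s y x (colv t) * h (colv t))%:E)%E.
Proof.
move=> [mh h0 hlam] indep.
pose G := \bigcup_j scalar_shock_events eps j.
have GO : <<s G >> `<=` @measurable _ Omega.
  apply: smallest_sub; first exact: sigma_algebra_measurable.
  by move=> _ [[i a] _ [B mB <-]]; exact: measurable_funP.
have mid : measurable_fun setT (id : Omega -> g_sigma_algebraType G).
  by move=> _ B mB; rewrite setTI; exact: GO.
pose mid' := isMeasurableFun.Build _ _ _ _ _ mid.
pose W : {RV P >-> g_sigma_algebraType G} := HB.pack (id : Omega ->
  g_sigma_algebraType G) mid'.
pose N : set (d.-tuple (measurableTypeR R) * g_sigma_algebraType G) :=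
  [set p | equilibria v S g s x (colv p.1) (fun i (a : Y i) => eps a p.2) y].
have mN : measurable N.
  rewrite (_ : N = \bigcap_(i in [set: 'I_n])
      [set p | best_response v S g s (y i) y x (colv p.1) (fun a =>
        eps a p.2)]).
    apply: fin_bigcap_measurable => // i _.
    apply: (@measurable_argmax R _ _ (Y i) (fun a p =>
      Vpayoff v S g s a y x (colv p.1) + (eps a : g_sigma_algebraType G ->
        R) p.2) (y i)) => a.
    apply: measurable_funD.
      by apply: (measurableT_comp (measurable_Vpayoff g s a y x)).
    apply: measurableT_comp => //; apply: measurable_shock => B eB.
    by apply: sub_sigma_algebra; exists (Tagged Y a).
  by apply/seteqP; split => w hw i => [_|]; exact: hw.
have indep' A B : measurable A -> measurable B ->
    P (lam @^-1` A `&` W @^-1` B) = (P (lam @^-1` A) * P (W @^-1` B))%E.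
  move=> mA mB; rewrite setIC muleC; apply: indep => //.
  (* An event on [lam] is an event on the pair of [xi] and [lam], with no constraint on [xi]. *)
  by exists (setT `*` A); [exact: measurableX|rewrite setTI; apply/seteqP;
    split => w //= []].
have := independent_density_integral mh (fun t => h0 (colv t)) hlam indep' mN.
rewrite /likelihood fineK ?fin_num_measure//; last first.
  have mlamW : measurable_fun setT (fun w =>
    (lam w, W w)) by exact: measurable_fun_pair.
  by have := mlamW measurableT N mN; rewrite setTI.
move=> ->; apply: eq_integral => t _.
rewrite EFinM /likelihood_given fineK ?fin_num_measure//;
  exact: measurable_equilibria.
Qed.

End shocks.
End payoffs.

Theorem theorem3 (R : realType)
  (n : nat) (Y : 'I_n -> finType)
  (dX : measure_display) (X : measurableType dX)
  (Xdiscrete : forall A : set X, measurable A)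
  (k : nat) (Gamma : set 'cV[R]_k) (Sigma : Type)
  (d : nat)
  (v : 'cV[R]_k -> forall i : 'I_n, profile Y -> X -> R)
  (S : Sigma -> forall i : 'I_n, 'M[R]_(#|Y i|, d))
  (v_affine : forall i y x, affine_on Gamma (fun g => v g i y x))
  (dO : measure_display) (Omega : measurableType dO) (P : probability Omega R)
  (xi : {RV P >-> X})
  (lam : {RV P >-> d.-tuple (measurableTypeR R)})
  (eps : forall i : 'I_n, Y i -> {RV P >-> R})
  (lam_eps_indep : mutually_independent P (all_shock_events eps lam))
  (lam_eps_x_indep :
     independent2 P (joint_events (all_shock_events eps lam)) (rv_events xi))
  (h : 'cV[R]_d -> R)
  (lam_density : has_lebesgue_density lam h)
  (h_log_concave : log_concave_on setT h)
  (eps_indep : mutually_independent P (scalar_shock_events eps))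
  (eps_x_lam_indep :
     independent2 P (joint_events (scalar_shock_events eps))
       (rv_events (fun w => (xi w, lam w))))
  (eps_gumbel : forall i a, std_gumbel (eps i a))
  (phi : profile Y -> X -> R)
  (phi_ge0 : forall y x, 0 <= phi y x)
  (phi_sum1 : forall x, \sum_(y : profile Y) phi y x = 1) :
  [/\ forall (i : 'I_n) (y : profile Y) (x : X) (l : 'cV[R]_d)
          (g : 'cV[R]_k) (s : Sigma), Gamma g ->
        best_response_prob v S eps g s (y i) y x l =
        expR (Vpayoff v S g s (y i) y x l) /
          \sum_(a : Y i) expR (Vpayoff v S g s a y x l),
      forall (y : profile Y) (x : X) (l : 'cV[R]_d)
          (g : 'cV[R]_k) (s : Sigma), Gamma g ->
        likelihood_given v S eps g s y x l =
        \prod_(i < n) (expR (Vpayoff v S g s (y i) y x l) /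
          \sum_(a : Y i) expR (Vpayoff v S g s a y x l)),
      forall (y : profile Y) (x : X) (g : 'cV[R]_k) (s : Sigma), Gamma g ->
        (likelihood v S eps (colv \o lam) g s y x)%:E =
        (\int[lebesgue_tuple d]_t
          ((\prod_(i < n) (expR (Vpayoff v S g s (y i) y x (colv t)) /
             \sum_(a : Y i) expR (Vpayoff v S g s a y x (colv t))))
           * h (colv t))%:E)%E,
      forall (s : Sigma) (y : profile Y) (x : X), log_concave_on Gamma
        (fun g => likelihood v S eps (colv \o lam) g s y x)
    & convex_set (Gamma : set (convex_lmodType _)) ->
      forall s, convex_set
        (identified_slice v S eps Gamma phi (colv \o lam) s
           : set (convex_lmodType _))].
Proof.
have logitP (i : 'I_n) (y : profile Y) x l g s : best_response_prob v S eps g s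
  (y i) y x l =
    expR (Vpayoff v S g s (y i) y x l) / \sum_(a : Y i) expR (Vpayoff v S g s a
      y x l).
  exact: best_response_prob_logit.
have givenP (y : profile Y) x l g s : likelihood_given v S eps g s y x l =
  logit_likelihood v S g s y x l.
  by rewrite (likelihood_given_prod _ _ _ _ _ _ _ lam_eps_indep);
    apply: eq_bigr => i _; exact: logitP.
have [mh h0 _] := lam_density.
have likP (y : profile Y) x g s : (likelihood v S eps (colv \o lam) g s y x)%:E
  =
    (\int[lebesgue_tuple d]_t (logit_likelihood v S g s y x (colv t) * h (colv
      t))%:E)%E.
  rewrite (likelihood_integral v S y x g s lam_density eps_x_lam_indep).
  by apply: eq_integral => t _; rewrite givenP.
have lik_ge0 (y : profile Y) x g s : 0 <=
  likelihood v S eps (colv \o lam) g s y x.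
  by rewrite fine_ge0.
have lik_log_concave s (y : profile Y) x :
    log_concave_on Gamma (fun g => likelihood v S eps (colv \o lam) g s y x).
  split=> [g _|t ga gb t01 Ga Gb Gc]; first exact: lik_ge0.
  (* In terms of [geo_le] the claim concerns three integrals over the common shock, as in
     [prekopa_leindler]. *)
  apply/geo_le_EFin => //; rewrite !likP.
  have mint g : measurable_fun setT (fun t : d.-tuple (measurableTypeR R) =>
      (logit_likelihood v S g s y x (colv t) * h (colv t))%:E).
    apply/measurable_EFinP; apply: measurable_funM => //.
    exact: measurable_logit_likelihood.
  have int0 g l : 0 <= logit_likelihood v S g s y x l * h l.
    by rewrite mulr_ge0// logit_likelihood_ge0.
  apply: prekopa_leindler => //; try by move=> p; rewrite lee_fin.
  move=> p q.
  apply/geo_le_EFin => //; rewrite colv_tuple_conv.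
  rewrite !powRM ?logit_likelihood_ge0// mulrACA ler_pM ?mulr_ge0 ?powR_ge0//.
    exact: logit_likelihood_log_concave.
  by have [_ hlc] := h_log_concave; exact: hlc.
split=> //.
move=> Gconv s; apply/convex_setW => a b;
  rewrite !inE => -[Ga La] [Gb Lb] t t0 t1.
(* [conv] puts the weight [t] on its first point, so log-concavity is used from [b] to [a]. *)
have convE : conv t (a : convex_lmodType _) b = (1 - t%:num) *: b + t%:num *: a.
  by rewrite addrC.
have Gc : Gamma ((1 - t%:num) *: b + t%:num *: a).
  by rewrite -convE -inE; apply: Gconv; rewrite inE.
rewrite convE; apply/mem_set; split => // y x.
have t01 : 0 < t%:num < 1 by rewrite t0.
have [_ /(_ _ _ _ t01 Gb Ga Gc)] := lik_log_concave s y x; apply: le_trans.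
(* [phi y x] is split into its powers of exponents [1 - t] and [t], each bounded by the same power
   of a likelihood. *)
rewrite -[leLHS]powRr1// -{1}(subrK t%:num 1) powRD;
  last by rewrite subrK oner_eq0.
by apply: ler_pM; rewrite ?powR_ge0// ge0_ler_powR ?nnegrE ?subr_ge0 ?(ltW t0)
  ?(ltW t1).
Qed.
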